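(* For every integer $n\geq 2$, the group $\mathbb{Z}^n\rtimes_{-I}\mathbb{Z}$ has Reidemeister spectrum $2\mathbb{N}\cup\{\infty\}$.
   Context: $\mathbb{N}$ denotes the set of positive integers. $\mathbb{Z}^n\rtimes_{-I}\mathbb{Z}$ denotes the semidirect product in which a generator of $\mathbb{Z}$ acts on $\mathbb{Z}^n$ by multiplication by $-I$. For a group $G$ and an endomorphism $\varphi$ of $G$, say $x\sim_\varphi y$ if there is $z\in G$ with $x=zy\varphi(z)^{-1}$; the Reidemeister number $R(\varphi)$ is the number of equivalence classes of $\sim_\varphi$ ($\infty$ if infinite). The Reidemeister spectrum of $G$ is $\mathrm{Spec}_R(G)=\{R(\varphi)\mid \varphi\in\mathrm{Aut}(G)\}$. *)

(* Defs.v *)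
From HB Require Import structures.
From mathcomp Require Import all_boot all_order all_algebra finmap.
From mathcomp Require Import mathcomp_extra boolp classical_sets cardinality.

Set Implicit Arguments.
Unset Strict Implicit.
Unset Printing Implicit Defensive.

Import GRing.Theory.

Local Open Scope classical_set_scope.
Local Open Scope group_scope.

Notation group_endo G := (monoid.UMagmaMorphism.type G G).

Section Reidemeister.
Variable G : groupType.

Definition twisted_conj (phi : G -> G) (x y : G) : Prop :=
  exists z : G, x = z * y * (phi z)^-1.

Definition twisted_class (phi : G -> G) (x : G) : set G :=
  [set y | twisted_conj phi x y].

(* Infinite cardinalities are not distinguished: None stands for infinity. *)
Definition reidemeister_number (phi : group_endo G) : option nat :=
  let classes := range (twisted_class phi) in
  if `[< finite_set classes >] then Some #|` fset_set classes|%fset else None.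

Lemma twisted_conj_refl (phi : group_endo G) (x : G) :
  twisted_conj phi x x.
Proof. by exists 1; rewrite mul1g gmulf1 invg1 mulg1. Qed.

Lemma twisted_conj_sym (phi : group_endo G) (x y : G) :
  twisted_conj phi x y -> twisted_conj phi y x.
Proof.
by case=> z ->; exists z^-1; rewrite gmulfV invgK !mulgA mulVg mul1g -mulgA mulVg mulg1.
Qed.

Lemma twisted_conj_trans (phi : group_endo G) (x y w : G) :
  twisted_conj phi x y -> twisted_conj phi y w -> twisted_conj phi x w.
Proof.
by case=> z -> [u ->]; exists (z * u); rewrite gmulfM invgM !mulgA.
Qed.

End Reidemeister.

Definition reidemeister_spectrum (G : groupType) : set (option nat) :=
  [set reidemeister_number phi |
     phi in [set phi : group_endo G | bijective phi]].

(* Actions of K on N by group automorphisms; bijectivity of [act k] follows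
   from the first two axioms. *)
Record aut_action (N K : groupType) := AutAction {
  act :> K -> N -> N;
  act1 : forall x, act 1 x = x;
  actM : forall s t x, act (s * t) x = act s (act t x);
  act_mul : forall t x y, act t (x * y) = act t x * act t y
}.

Definition semidirect (N K : groupType) (a : aut_action N K) : Type :=
  (N * K)%type.

Section SemidirectGroup.
Variables (N K : groupType) (a : aut_action N K).

HB.instance Definition _ := Choice.copy (semidirect a) (N * K)%type.

Definition sd_one : semidirect a := (1, 1).
Definition sd_mul (x y : semidirect a) : semidirect a :=
  (x.1 * a x.2 y.1, x.2 * y.2).
Definition sd_inv (x : semidirect a) : semidirect a :=
  (a x.2^-1 x.1^-1, x.2^-1).

Lemma act_one t : a t 1 = 1.
Proof. by apply: (mulgI (a t 1)); rewrite -act_mul !mulg1. Qed.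

Lemma sd_mulA : associative sd_mul.
Proof.
by move=> x y z; rewrite /sd_mul /= act_mul actM !mulgA.
Qed.

Lemma sd_mul1g : left_id sd_one sd_mul.
Proof. by case=> x t; rewrite /sd_mul /= act1 !mul1g. Qed.

Lemma sd_mulg1 : right_id sd_one sd_mul.
Proof. by case=> x t; rewrite /sd_mul /= act_one !mulg1. Qed.

Lemma sd_mulVg : left_inverse sd_one sd_inv sd_mul.
Proof.
by case=> x t; rewrite /sd_mul /= -act_mul !mulVg act_one.
Qed.

Lemma sd_mulgV : right_inverse sd_one sd_inv sd_mul.
Proof.
by case=> x t; rewrite /sd_mul /= -actM mulgV act1 mulgV.
Qed.

HB.instance Definition _ :=
  isGroup.Build (semidirect a)
    sd_mulA sd_mul1g sd_mulg1 sd_mulVg sd_mulgV.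

End SemidirectGroup.

Section NegAction.
Variable n : nat.
Local Open Scope ring_scope.

(* (-I)^t = ((-1)^t) I; the latter makes sense for every t : int without
   requiring a ring structure on 'M_n. *)
Definition neg_act (t : Algebra.to_multiplicative int)
    (v : Algebra.to_multiplicative 'cV[int]_n) : Algebra.to_multiplicative 'cV[int]_n :=
  ((-1) ^ t)%:M *m v.

Lemma neg_act_gen v : neg_act 1%Z v = (- 1%:M) *m v.
Proof. by rewrite /neg_act expr1z raddfN. Qed.

Lemma neg_act1 v : neg_act 1%g v = v.
Proof. by rewrite /neg_act expr0z mul1mx. Qed.

Lemma neg_actM s t v : neg_act (s * t)%g v = neg_act s (neg_act t v).
Proof.
by rewrite /neg_act mulmxA -scalar_mxM -exprzDr ?unitrN1.
Qed.

Lemma neg_act_mul t v w :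
  neg_act t (v * w)%g = (neg_act t v * neg_act t w)%g.
Proof. exact: mulmxDr. Qed.

Definition neg_action :=
  AutAction neg_act1 neg_actM neg_act_mul.

End NegAction.

Definition Zn_rtimes_negI_Z (n : nat) : groupType :=
  semidirect (neg_action n).

(* Main.v *)
(* An automorphism phi of Z^n x|_(-I) Z acts on Z^n by a matrix M and on the
   quotient Z by a sign. If the sign is 1, the classes are separated by their
   image in Z, so R(phi) is infinite. If it is -1, the classes lying over even
   (resp. odd) integers correspond to the cokernel of I - M (resp. I + M), so
   R(phi) = |det (I - M)| + |det (I + M)|, infinite when a determinant vanishes.
   The two determinants agree modulo 2, so this is even. Companion matrices whose
   characteristic polynomial p satisfies p(0) = -1 and |p(1)| = |p(-1)| = k
   realise 2k. *)
From HB Require Import structures.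
Require Import Defs.
From mathcomp Require Import all_boot all_order all_algebra.
From mathcomp Require Import boolp classical_sets.
From mathcomp Require Import finmap cardinality zify.

Set Implicit Arguments.
Unset Strict Implicit.
Unset Printing Implicit Defensive.

Import Order.TTheory GRing.Theory Num.Theory.

Local Open Scope classical_set_scope.
Local Open Scope ring_scope.

(** * Counting twisted conjugacy classes by representatives *)

Section ReidemeisterNumber.
Variables (G : groupType) (phi : group_endo G).

Lemma twisted_class_eqP x y :
  twisted_class phi x = twisted_class phi y <-> twisted_conj phi x y.
Proof.
split=> [e | xy].
  suff: twisted_class phi x y by [].
  by rewrite e; apply: twisted_conj_refl.
rewrite eqEsubset; split=> z; apply: twisted_conj_trans => //.
exact: twisted_conj_sym.
Qed.

Lemma reidemeister_number_fin (T : finType) (h : T -> G) :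
    (forall i j, twisted_conj phi (h i) (h j) -> i = j) ->
    (forall x, exists i, twisted_conj phi x (h i)) ->
  reidemeister_number phi = Some #|T|.
Proof.
move=> hI hS; pose c := fun i => twisted_class phi (h i).
have cI : injective c by move=> i j /twisted_class_eqP/hI.
pose s := [fset c i | i in T]%fset.
have sE : range (twisted_class phi) = [set` s].
  apply/seteqP; split=> A /=.
    move=> [x _ <-]; have [i /twisted_class_eqP ->] := hS x.
    exact: in_imfset.
  by case/imfsetP=> i _ ->; exists (h i).
rewrite /reidemeister_number sE set_fsetK.
case: asboolP => [_ | []]; last exact: finite_fset.
by rewrite card_imfset //= cardE enumT.
Qed.

Lemma reidemeister_number_infty (h : nat -> G) :
  (forall i j, twisted_conj phi (h i) (h j) -> i = j) ->
  reidemeister_number phi = None.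
Proof.
move=> hI; rewrite /reidemeister_number; case: asboolP => // fin.
have cI : injective (fun i => twisted_class phi (h i)).
  by move=> i j /twisted_class_eqP/hI.
suff: infinite_set (range (twisted_class phi)) by [].
apply/infiniteP; rewrite -(card_le_eql (inj_card_eq (in2W cI))).
by apply: subset_card_le => _ [i _ <-]; exists (h i).
Qed.

End ReidemeisterNumber.

Lemma absz_det_unitmx (n : nat) (U : 'M[int]_n) :
  U \in unitmx -> `|\det U|%N = 1%N.
Proof. by rewrite unitmxE qualifE => /orP[] /eqP ->. Qed.

(** * Cokernels of integer matrices *)

Section Cokernel.
Variables (n : nat) (A : 'M[int]_n).

(** Smith normal form writes [A] as a diagonal matrix between two unimodular ones, so the cokernel
    is a product of cyclic groups of orders [|D_i|], and unimodular factors do not change the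
    absolute value of the determinant. *)
Lemma coker_finite : \det A != 0 ->
  exists (T : finType) (h : T -> 'cV[int]_n),
    [/\ #|T| = `|\det A|%N,
        forall i j v, h i = h j + A *m v -> i = j
      & forall x, exists i v, x = h i + A *m v].
Proof.
have [L uL [R uR [d _ AE]]] := int_Smith_normal_form A.
have {d AE} [D AE] : exists D : 'rV[int]_n, A = L *m diag_mx D *m R.
  exists (\row_i d`_i); rewrite AE; congr (_ *m _ *m _); apply/matrixP=> i j.
  by rewrite !mxE; congr (_ *+ _); rewrite val_eqE.
have detE : `|\det A|%N = (\prod_i `|D 0%R i|)%N.
  rewrite AE !det_mulmx !abszM (absz_det_unitmx uL) (absz_det_unitmx uR) mul1n.
  rewrite muln1 det_diag.
  by elim/big_rec2: _ => // i x y _ <-; rewrite abszM.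
rewrite -absz_eq0 detE => prodD.
have D0 i : D 0 i != 0.
  by apply: contraNneq prodD => Di; rewrite (bigD1 i) //= Di mul0n.
(* Representatives: vectors of residues, the i-th one in [0, |D_i|), carried over by [L]. *)
pose T : finType := {dffun forall i : 'I_n, 'I_`|D 0%R i|%N}.
pose h (f : T) : 'cV[int]_n := L *m \col_i (f i : nat)%:Z.
exists T, h; split.
- rewrite card_dep_ffun foldrE big_image /=.
  by apply: eq_bigr => i _; rewrite card_ord.
- move=> f g v /(congr1 (mulmx (invmx L))).
  rewrite AE -!mulmxA -mulmxDr !mulKmx // => /matrixP fg.
  apply/ffunP => i; apply/val_inj/eqP; rewrite -eqz_nat; apply/eqP.
  have fgi : (f i : nat)%:Z = D 0 i * (R *m v) i 0 + (g i : nat)%:Z.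
    by have := fg i 0; rewrite mul_diag_mx addrC !mxE.
  have: ((f i : nat)%:Z = (g i : nat)%:Z %[mod D 0%R i])%Z.
    by rewrite fgi mulrC modzMDl.
  by rewrite -!(modz_abs _ (D 0 i)) !modz_small //= ltz_nat ltn_ord.
move=> x; have [y ->] : exists y, x = L *m y.
  by exists (invmx L *m x); rewrite mulKVmx.
have modD i : (`|(y i 0%R %% D 0%R i)%Z| < `|D 0%R i|)%N.
  by rewrite -ltz_nat gez0_abs ?modz_ge0 // ltz_mod.
(* Coordinatewise Euclidean division of [y] by [D]: remainders give the representative, quotients
   the preimage. *)
exists [ffun i => Ordinal (modD i)].
exists (invmx R *m \col_i (y i 0%R %/ D 0%R i)%Z).
rewrite AE -!mulmxA -mulmxDr mulKVmx // mul_diag_mx.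
congr (_ *m _); apply/matrixP=> i j.
rewrite !ord1 !mxE ffunE /= gez0_abs ?modz_ge0 // addrC [_ * (_ %/ _)%Z]mulrC.
exact: divz_eq.
Qed.

(** A nonzero row [w] with [w *m A = 0] is a functional on the cokernel. Where its k-th entry is
    nonzero, it separates the multiples of the k-th basis vector. *)
Lemma coker_infinite : \det A = 0 ->
  exists h : nat -> 'cV[int]_n, forall i j v, h i = h j + A *m v -> i = j.
Proof.
move=> /eqP/det0P[w w0 wA].
have [k wk] : exists k, w 0 k != 0.
  apply/existsP; apply: contraNT w0 => /existsPn w0.
  by apply/eqP/rowP => k; rewrite mxE; apply/eqP; move: (w0 k); rewrite negbK.
exists (fun i => \col_l (i%:Z *+ (l == k))) => i j v /(congr1 (mulmx w)).
rewrite mulmxDr mulmxA wA mul0mx addr0 => /matrixP/(_ 0 0).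
have wh (m : nat) : (w *m \col_l (m%:Z *+ (l == k))) 0 0 = w 0 k * m%:Z.
  rewrite mxE (bigD1 k) //= mxE eqxx mulr1n big1 ?addr0 // => l lk.
  by rewrite mxE (negPf lk) mulr0.
by rewrite !wh => /(mulfI wk) [].
Qed.

End Cokernel.

(** * The determinants of I - M and I + M: parity and realisation *)

Lemma odd_absz_det1BD (n : nat) (M : 'M[int]_n) :
  odd `|\det (1%:M - M)| = odd `|\det (1%:M + M)|.
Proof.
have F2 : (2 \in [pchar 'F_2])%N by apply: pchar_Fp.
apply: (can_inj negbK); rewrite -!dvdn2 -!(dvdzE 2) !(dvdz_pcharf F2).
(* Over F_2 the two matrices coincide, since -M = M there. *)
rewrite -!(det_map_mx intr) map_mxB map_mxD; congr (\det (_ + _) == 0).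
apply/matrixP => i j; rewrite !mxE.
by apply/eqP; rewrite -subr_eq0 -opprD oppr_eq0 -mulr2n -mulr_natl pchar_Zp ?mul0r.
Qed.

Lemma exists_matrix_char_poly (n : nat) (p : {poly int}) :
  p \is monic -> size p = n.+1 -> exists M : 'M[int]_n, char_poly M = p.
Proof.
move=> p_monic sp; have -> : n = (size p).-1 by rewrite sp.
by exists (companionmx p); apply: companionmxK.
Qed.

Lemma horner_char_poly (R : comNzRingType) (n : nat) (M : 'M[R]_n) x :
  (char_poly M).[x] = \det (x%:M - M).
Proof.
rewrite -[LHS]/(horner_eval x _) -det_map_mx; congr (\det _).
apply/matrixP=> i j; rewrite !mxE rmorphB rmorphMn /= /horner_eval.
by rewrite hornerX hornerC.
Qed.

Lemma exists_unitmx_det1BD (n k : nat) : (2 <= n)%N ->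
  exists M : 'M[int]_n, [/\ M \in unitmx, `|\det (1%:M - M)|%N = k
    & `|\det (1%:M + M)|%N = k].
Proof.
move=> n2.
have [q [sq q0 q1 qN1]] : exists q : {poly int},
  [/\ (size q <= n)%N, q`_0 = -1, `|(1 + q.[1])%R|%N = k
    & `|((-1) ^+ n + q.[-1])%R|%N = k].
  (* With p = X^n + q, take q = (k+1)X^2 - X - 1 for odd n, which has degree below n because n >= 3;
     then p(1) = p(-1) = k. For even n, q = -kX - 1 gives p(1) = -k and p(-1) = k. *)
  case: (boolP (odd n)) => n_odd.
    exists (Poly [:: -1; -1; k%:Z + 1]); split.
    - by apply: leq_trans (size_Poly _) _; case: n n2 n_odd => [|[|[]]].
    - by rewrite coef_Poly.
    - by rewrite horner_Poly /=; lia.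
    - by rewrite horner_Poly -signr_odd n_odd /=; lia.
  exists (Poly [:: -1; - k%:Z]); split.
  - exact: leq_trans (size_Poly _) _.
  - by rewrite coef_Poly.
  - by rewrite horner_Poly /=; lia.
  - by rewrite horner_Poly -signr_odd (negPf n_odd) /=; lia.
have sXq : (size q < size ('X^n : {poly int}))%N by rewrite size_polyXn.
have [||M Mp] := @exists_matrix_char_poly n ('X^n + q).
- by rewrite monicE lead_coefDl // lead_coefXn.
- by rewrite size_polyDl // size_polyXn.
exists M; split.
(* Up to the sign (-1)^n, det M is p(0) = -1. *)
- have s_unit : ((-1) ^+ n : int) \is a GRing.unit by rewrite unitrX ?unitrN1.
  rewrite unitmxE -(unitrMr _ s_unit) -char_poly_det Mp coefD coefXn q0.
  by rewrite ltn_eqF ?add0r ?unitrN1 // ltnW.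
- by rewrite -horner_char_poly Mp hornerD hornerXn expr1n.
- have -> : 1%:M + M = - ((-1)%:M - M) by rewrite opprB raddfN opprK addrC.
  rewrite -[- (_ - M)]scaleN1r detZ abszM abszX abszN1 exp1n mul1n.
  by rewrite -horner_char_poly Mp hornerD hornerXn.
Qed.

Lemma additive_mulmx (n : nat) (f : 'cV[int]_n -> 'cV[int]_n) :
  {morph f : v w / v + w} -> exists M : 'M[int]_n, forall v, f v = M *m v.
Proof.
move=> fD; have f0 : f 0 = 0 by apply: (addrI (f 0)); rewrite -fD !addr0.
pose fa : {additive 'cV[int]_n -> 'cV[int]_n} :=
  HB.pack f (GRing.isNmodMorphism.Build _ _ f (f0, fD)).
exists (\matrix_(i, j) f (delta_mx j 0) i 0) => v.
rewrite [v in LHS]matrix_sum_delta -[f]/(fa : _ -> _) raddf_sum.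
apply/matrixP=> i j; rewrite summxE mxE; apply: eq_bigr => l _.
rewrite big_ord1 mxE ord1 -[v l 0]intz scaler_int raddfMz.
by rewrite -scaler_int mxE !intz mulrC !ord1.
Qed.

Lemma additive_int (g : int -> int) :
  {morph g : s t / s + t} -> forall s, g s = g 1 * s.
Proof.
move=> gD s; have g0 : g 0 = 0 by apply: (addrI (g 0)); rewrite -gD !addr0.
pose ga : {additive int -> int} :=
  HB.pack g (GRing.isNmodMorphism.Build _ _ g (g0, gD)).
by rewrite -[s in LHS]intz -[g]/(ga : _ -> _) raddfMz mulrzz.
Qed.

Lemma twisted_conjE (G : groupType) (phi : G -> G) (x y : G) :
  twisted_conj phi x y <-> exists z, (x * phi z = z * y)%g.
Proof.
by split=> -[z e]; exists z; [rewrite e mulgVK | rewrite -e mulgK].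
Qed.

(** * Endomorphisms of the semidirect product and their twisted classes *)

Section NegISemidirect.
Variable n : nat.
Implicit Types (v w : 'cV[int]_n) (s t : int).
Local Notation G := (Zn_rtimes_negI_Z n).

Definition elt v s : G := (v, s).

(* The projection onto the quotient Z, typed as [int] rather than as its
   multiplicative copy so that [lia] applies. *)
Definition ht (x : G) : int := x.2.

Lemma eltE (x : G) : x = elt x.1 (ht x).
Proof. by case: x. Qed.

Lemma ht_elt v s : ht (elt v s) = s.
Proof. by []. Qed.

Lemma eltM v s w t : (elt v s * elt w t)%g = elt (v + (-1) ^ s *: w) (s + t).
Proof. by rewrite -mul_scalar_mx. Qed.

Lemma htM (x y : G) : ht (x * y)%g = ht x + ht y.
Proof. by []. Qed.

Section HeightOpp.
Variables (phi : group_endo G) (M : 'M[int]_n).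
Hypothesis phi_Zn : forall v, phi (elt v 0) = elt (M *m v) 0.
Hypothesis phi_ht : forall x, ht (phi x) = - ht x.

(** As [phi] negates heights, conjugating by [z] shifts the height by [2 * ht z]. Equal heights thus
    force [z] into Z^n, where moving it past height [t] costs the sign (-1)^t. *)
Lemma twisted_conj_same_ht v w t :
  twisted_conj phi (elt v t) (elt w t) <->
  exists u, v = w + (1%:M - (-1) ^ t *: M) *m u.
Proof.
rewrite twisted_conjE; split=> [[z e] | [u ->]].
  have z2 : ht z = 0.
    by have := congr1 ht e; rewrite !htM phi_ht !ht_elt; lia.
  exists z.1; move: e; rewrite (eltE z) z2 phi_Zn !eltM expr0z scale1r.
  case=> e _; rewrite mulmxBl mul1mx -scalemxAl.
  by rewrite addrA [w + _]addrC -e addrK.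
exists (elt u 0); rewrite phi_Zn !eltM expr0z scale1r add0r addr0; congr elt.
by rewrite mulmxBl mul1mx -scalemxAl addrA subrK addrC.
Qed.

Lemma twisted_conj_ht_parity v s t :
  exists w, twisted_conj phi (elt v (t + 2 * s)) (elt w t).
Proof.
set x := elt v _; pose y := (x * phi (elt 0 s))%g.
(* Obtained by solving [y = elt 0 s * elt w t] for [w]; (-1)^s is its own inverse. *)
exists ((-1) ^ s *: y.1); apply/twisted_conjE; exists (elt 0 s).
rewrite eltM add0r scalerA -[LHS]/y (eltE y).
have -> : ht y = s + t by rewrite /y htM phi_ht !ht_elt; lia.
by rewrite -exprzMl ?unitrN1 // mulrNN mulr1 exp1rz scale1r.
Qed.

Lemma reidemeister_number_ht_opp :
  reidemeister_number phi =
  if (\det (1%:M - M) == 0) || (\det (1%:M + M) == 0) then None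
  else Some (`|\det (1%:M - M)| + `|\det (1%:M + M)|)%N.
Proof.
have B0 : 1%:M - (-1) ^ 0 *: M = 1%:M - M by rewrite expr0z scale1r.
have B1 : 1%:M - (-1) ^ 1 *: M = 1%:M + M by rewrite expr1z scaleN1r opprK.
have infty t : \det (1%:M - (-1) ^ t *: M) = 0 -> reidemeister_number phi = None.
  move=> /coker_infinite[h hI].
  apply: (@reidemeister_number_infty _ _ (fun i => elt (h i) t)) => i j.
  by move=> /twisted_conj_same_ht[u]; apply: hI.
have [d0|d0] := eqVneq; first by apply: (infty 0); rewrite B0.
have [d1|d1] := eqVneq; first by apply: (infty 1); rewrite B1.
have [T0 [h0 [<- h0I h0S]]] := coker_finite d0.
have [T1 [h1 [<- h1I h1S]]] := coker_finite d1.
rewrite -card_sum.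
pose h (i : T0 + T1) :=
  match i with inl i => elt (h0 i) 0 | inr i => elt (h1 i) 1 end.
(* Comparing heights would give - ht z = ht z + 1, impossible by parity. *)
have ht01 v w : ~ twisted_conj phi (elt v 0) (elt w 1).
  move=> /twisted_conjE[z /(congr1 ht)].
  by rewrite !htM phi_ht !ht_elt; lia.
apply: (@reidemeister_number_fin _ _ _ h) => [[]i []j /= | x].
- by move=> /twisted_conj_same_ht[u]; rewrite B0 => /h0I ->.
- by move=> /ht01.
- by move=> /twisted_conj_sym/ht01.
- by move=> /twisted_conj_same_ht[u]; rewrite B1 => /h1I ->.
have [s [sE|sE]] : exists s, ht x = 0 + 2 * s \/ ht x = 1 + 2 * s.
  exists (ht x %/ 2)%Z; lia.
- have [w xw] := twisted_conj_ht_parity x.1 s 0.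
  have [i [u wE]] := h0S w; exists (inl i).
  rewrite (eltE x) sE; apply: twisted_conj_trans xw _.
  by apply/twisted_conj_same_ht; exists u; rewrite B0.
- have [w xw] := twisted_conj_ht_parity x.1 s 1.
  have [i [u wE]] := h1S w; exists (inr i).
  rewrite (eltE x) sE; apply: twisted_conj_trans xw _.
  by apply/twisted_conj_same_ht; exists u; rewrite B1.
Qed.

End HeightOpp.

Lemma reidemeister_number_ht_id (phi : group_endo G) :
  (forall x, ht (phi x) = ht x) -> reidemeister_number phi = None.
Proof.
move=> phi_ht.
apply: (@reidemeister_number_infty _ _ (fun i => elt 0 i%:Z)) => i j.
move=> /twisted_conjE[z /(congr1 ht)].
by rewrite !htM phi_ht !ht_elt; lia.
Qed.

Lemma group_endo_form (phi : group_endo G) :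
  exists (M : 'M[int]_n) (e : int),
    (forall v, phi (elt v 0) = elt (M *m v) 0) /\
    (forall x, ht (phi x) = e * ht x).
Proof.
have phi0 v : ht (phi (elt v 0)) = 0.
  (* The generator of Z inverts v, so the image of v in Z is its own opposite. *)
  have : (elt v 0 * elt 0 1 * elt v 0 = elt 0 1)%g.
    by rewrite !eltM expr1z scaleN1r scaler0 addr0 subrr.
  move=> /(congr1 phi)/(congr1 ht).
  rewrite !gmulfM !htM.
  by move: (ht (phi (elt v 0))) (ht (phi (elt 0 1))) => a b; lia.
have phi0E v : phi (elt v 0) = elt (phi (elt v 0)).1 0 by rewrite [LHS]eltE phi0.
have [v w|M ME] := @additive_mulmx n (fun v => (phi (elt v 0)).1).
  have -> : elt (v + w) 0 = (elt v 0 * elt w 0)%g by rewrite eltM expr0z scale1r.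
  by rewrite gmulfM [in LHS]phi0E [phi (elt w 0) in LHS]phi0E eltM expr0z scale1r.
exists M, (ht (phi (elt 0 1))); split=> [v | x]; first by rewrite phi0E ME.
(* The induced endomorphism of the quotient Z is multiplication by the image of 1. *)
have eD : {morph (fun s => ht (phi (elt 0 s))) : s t / s + t}.
  move=> s t; rewrite -htM -gmulfM eltM scaler0 addr0.
  by [].
rewrite -(additive_int eD) [in LHS](eltE x).
have -> : elt x.1 (ht x) = (elt x.1 0 * elt 0 (ht x))%g.
  by rewrite eltM scaler0 addr0 add0r.
by rewrite gmulfM htM phi0 add0r.
Qed.

Section MatrixAut.
Variable M : 'M[int]_n.

Definition mx_endo (x : G) : G := elt (M *m x.1) (- ht x).

Lemma mx_endoM : {morph mx_endo : x y / (x * y)%g}.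
Proof.
move=> x y; rewrite [x]eltE [y]eltE eltM /mx_endo /= eltM opprD.
(* Negating the height respects the action because (-1)^(-s) = (-1)^s. *)
by rewrite mulmxDr -scalemxAr -exprz_inv invrN1.
Qed.

Lemma mx_endo1 : mx_endo 1%g = 1%g.
Proof. by rewrite /mx_endo mulmx0 oppr0. Qed.

HB.instance Definition _ :=
  monoid.isUMagmaMorphism.Build G G mx_endo (mx_endo1, mx_endoM).

Lemma mx_endo_bij : M \in unitmx -> bijective mx_endo.
Proof.
move=> uM; exists (fun x => elt (invmx M *m x.1) (- ht x)) => x.
  by rewrite [RHS]eltE /mx_endo /= mulKmx // opprK.
by rewrite [RHS]eltE /mx_endo /= mulKVmx // opprK.
Qed.

End MatrixAut.
End NegISemidirect.

Local Close Scope ring_scope.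

Theorem proposition4p8 (n : nat) (hn : (2 <= n)%N) :
  reidemeister_spectrum (Zn_rtimes_negI_Z n) =
  [set Some (2 * k)%N | k in [set k : nat | (0 < k)%N]] `|` [set None].
Proof.
apply/seteqP; split=> [_ [phi bij_phi <-] | o].
  have [M [e [phi_Zn phi_ht]]] := group_endo_form phi.
  have [psi _ psiK] := bij_phi.
  (* Surjectivity of [phi] makes 1 a multiple of [e], so [e] is 1 or -1. *)
  have : (e \is a GRing.unit)%R.
    by apply/unitrPr; exists (ht (psi (elt 0 1))); rewrite -phi_ht psiK.
  rewrite qualifE => /orP[] /eqP eE.
    by right; apply: reidemeister_number_ht_id => x; rewrite phi_ht eE mul1r.
  rewrite (reidemeister_number_ht_opp phi_Zn) => [|x]; last first.
    by rewrite phi_ht eE mulN1r.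
  case: ifPn => [_|]; [by right | rewrite -!absz_eq0 => /norP[d0 d1]; left].
  have := odd_absz_det1BD M; set a := `|_|%N; set b := `|_|%N => ab.
  exists ((a + b)./2); rewrite /= -?/a -?/b in d0 d1 *; last by congr Some; lia.
  lia.
case=> [[k k0 <-] | ->]; last first.
  (* The identity preserves heights, hence realises infinity. *)
  exists idfun; first by exists id.
  exact: reidemeister_number_ht_id.
have [M [uM M1 MN1]] := exists_unitmx_det1BD k hn.
exists (mx_endo M); first exact: mx_endo_bij.
rewrite (@reidemeister_number_ht_opp _ _ M) // -!absz_eq0 M1 MN1.
by rewrite gtn_eqF //= mul2n addnn.
Qed.
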